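(* Let $\Gamma$ be a finite, simple, connected, undirected graph with vertex set $X$, adjacency matrix $A$ and $d+1$ distinct eigenvalues, and let $\{R_0,R_1,\ldots,R_r\}$ be the walk-regular partition of $X\times X$. Then $d\le r$. Furthermore, with $Z$ and $\mathcal{W}=\{\mathbf{w}(y,z)\mid y,z\in X\}$ as defined in the context, the following are equivalent: (i) $d=r$; (ii) $Z=I$; (iii) $|\mathcal{W}|=d+1$; (iv) $\mathcal{W}$ is a linearly independent set; (v) $\Gamma$ is quotient-polynomial.
   Context: For $y,z\in X$ let $\mathbf{w}(y,z)=((A^0)_{yz},(A^1)_{yz},\ldots,(A^d)_{yz})^\top\in\mathbb{C}^{d+1}$. The walk-regular partition $\{R_0,\ldots,R_r\}$ of $X\times X$ has classes such that $(y,z),(u,v)$ lie in the same class iff $\mathbf{w}(y,z)=\mathbf{w}(u,v)$; let $M_j$ be the $(0,1)$ adjacency matrix of $R_j$. Let $w_{ij}$ be the common value of $(A^i)_{yz}$ for $(y,z)\in R_j$ ($0\le i\le d$, $0\le j\le r$), $W=[w_{ij}]$ the $(d+1)\times(r+1)$ matrix, and $Z$ the reduced row echelon form of $W$. $\Gamma$ is quotient-polynomial if every $M_j$ lies in $\operatorname{span}\{I,A,\ldots,A^d\}$. *)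

(* Defs.v *)
From HB Require Import structures.
From mathcomp Require Import all_boot all_order all_algebra.
From mathcomp Require Import complex reals.

Set Implicit Arguments.
Unset Strict Implicit.
Unset Printing Implicit Defensive.

Import GRing.Theory.
Local Open Scope ring_scope.

Definition connected_graph (X : finType) (e : rel X) : Prop :=
  forall x y : X, connect e x y.

(* Matrices indexed by X are square matrices of size #|X|, through the
   library bijection enum_rank / enum_val between X and 'I_#|X|. *)
Definition entry (F : Type) (X : finType) (B : 'M[F]_#|X|) (y z : X) : F :=
  B (enum_rank y) (enum_rank z).

Definition rel_mx (F : fieldType) (X : finType) (S : {set X * X}) :
    'M[F]_#|X| :=
  \matrix_(i, j) ((enum_val i, enum_val j) \in S)%:R.

Definition adj_mx (F : fieldType) (X : finType) (e : rel X) : 'M[F]_#|X| :=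
  \matrix_(i, j) (e (enum_val i) (enum_val j))%:R.

Definition has_distinct_eigenvalues (F : fieldType) (n : nat) (A : 'M[F]_n)
    (k : nat) : Prop :=
  exists s : seq F, [/\ uniq s, size s = k & forall a, (a \in s) = eigenvalue A a].

Section Walks.

Variables (F : fieldType) (X : finType) (A : 'M[F]_#|X|) (d : nat).

Definition walk_vec (y z : X) : 'cV[F]_d.+1 :=
  \col_(i < d.+1) entry (A ^+ i) y z.

Definition walk_vecs : seq 'cV[F]_d.+1 :=
  undup [seq walk_vec p.1 p.2 | p : X * X].

Definition walk_partition : {set {set X * X}} :=
  preim_partition (fun p : X * X => walk_vec p.1 p.2) [set: X * X].

Definition enumerates_walk_partition (r : nat)
    (Rel : 'I_r.+1 -> {set X * X}) : Prop :=
  injective Rel /\ [set Rel j | j : 'I_r.+1] = walk_partition.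

(* Column j is read off at an arbitrary pair of Rel j; when Rel enumerates
   walk_partition, Rel j is nonempty and the value does not depend on the pair. *)
Definition walk_matrix (r : nat) (Rel : 'I_r.+1 -> {set X * X}) :
    'M[F]_(d.+1, r.+1) :=
  \matrix_(i, j)
    (if [pick p in Rel j] is Some p then entry (A ^+ i) p.1 p.2 else 0).

Definition quotient_polynomial (r : nat) (Rel : 'I_r.+1 -> {set X * X}) : Prop :=
  forall j : 'I_r.+1,
    rel_mx F (Rel j) \in <<[seq A ^+ (i : 'I_d.+1) | i : 'I_d.+1]>>%VS.

End Walks.

Section ReducedRowEchelonForm.

Variables (F : fieldType) (m n : nat).
Implicit Types B Z : 'M[F]_(m, n).

Definition leading_entry Z (i : 'I_m) (j : 'I_n) : Prop :=
  Z i j != 0 /\ forall k : 'I_n, (k < j)%N -> Z i k = 0.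

Definition is_rref Z : Prop :=
  [/\ forall i i' : 'I_m, (i < i')%N -> row i Z = 0 -> row i' Z = 0,
      forall (i i' : 'I_m) (j j' : 'I_n), (i < i')%N ->
        leading_entry Z i j -> leading_entry Z i' j' -> (j < j')%N,
      forall i j, leading_entry Z i j -> Z i j = 1 &
      forall i i' j, leading_entry Z i j -> i' != i -> Z i' j = 0].

Definition row_equivalent B Z : Prop :=
  exists2 P : 'M[F]_m, P \in unitmx & Z = P *m B.

Definition rref_of B Z : Prop := row_equivalent B Z /\ is_rref Z.

(* Z has to be square, which is part of the assertion Z = I. *)
Definition is_identity_mx Z : Prop :=
  exists e : n = m, castmx (erefl m, e) Z = 1%:M.

End ReducedRowEchelonForm.

(* Main.v *)
Require Import Defs.
From HB Require Import structures.
From mathcomp Require Import all_boot all_order all_algebra.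
From mathcomp Require Import complex reals zify.

(** Each of the [d.+1] distinct eigenvalues of [A] is a root of any polynomial
    that annihilates [A], so the powers [A^0, ..., A^d] are linearly
    independent; equivalently the walk matrix [W] has independent rows, whence
    [d <= r] and [d = r] iff [W] is left invertible.  The columns of [W] are the
    distinct walk vectors, and a relation [M_j = \sum_i C j i A^i] for all [j]
    says exactly that [C *m W = 1]. *)

Import GRing.Theory.
Local Open Scope ring_scope.
Local Open Scope complex_scope.

(** * Eigenvalues and independence of matrix powers *)

Section Eigenvalues.

Set Implicit Arguments.
Unset Strict Implicit.

Variables (F : fieldType) (n : nat) (A : 'M[F]_n).

Lemma eigenvector_exp (v : 'rV[F]_n) (a : F) (k : nat) :
  v *m A = a *: v -> v *m A ^+ k = a ^+ k *: v.
Proof.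
move=> vA; elim: k => [|k IHk]; first by rewrite !expr0 mulmx1 scale1r.
by rewrite !exprSr -mulmxE mulmxA IHk -scalemxAl vA scalerA.
Qed.

Lemma powers_independent (d : nat) (c : 'I_d -> F) :
  has_distinct_eigenvalues A d -> \sum_(i < d) c i *: A ^+ i = 0 ->
  forall i, c i = 0.
Proof.
move=> [s [s_uniq s_size sP]] cA0.
pose p : {poly F} := \sum_(i < d) c i *: 'X^i.
have coef_p (i : 'I_d) : p`_i = c i.
  rewrite coef_sum (bigD1 i) //= coefZ coefXn eqxx mulr1 big1 ?addr0 // => j ji.
  by rewrite coefZ coefXn eq_sym (inj_eq val_inj) (negPf ji) mulr0.
have size_p : (size p <= d)%N.
  apply: (leq_trans (size_sum _ _ _)); apply/bigmax_leqP => i _.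
  by apply: (leq_trans (size_scale_leq _ _)); rewrite size_polyXn.
have p_roots : all (root p) s.
  apply/allP => a; rewrite sP => /eigenvalueP[v vA v_neq0].
  (* A left eigenvector for [a] turns the matrix [p(A)] into the scalar [p.[a]], so [p(A) = 0] makes
     [a] a root. With [d] distinct roots and [size p <= d], [p] must vanish. *)
  have : v *m \sum_(i < d) c i *: A ^+ i = p.[a] *: v.
    rewrite mulmx_sumr horner_sum scaler_suml; apply: eq_bigr => i _.
    by rewrite -scalemxAr (eigenvector_exp _ vA) hornerZ hornerXn scalerA.
  by rewrite cA0 mulmx0 => /esym/eqP; rewrite scaler_eq0 (negPf v_neq0) orbF.
have p0 : p = 0.
  apply/eqP; apply: contraT => p_neq0.
  by have := max_poly_roots p_neq0 p_roots s_uniq; rewrite s_size ltnNge size_p.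
by move=> i; rewrite -coef_p p0 coef0.
Qed.

End Eigenvalues.

(** * Reduced row echelon forms of full row rank *)

Section ReducedRowEchelonForm.

Set Implicit Arguments.
Unset Strict Implicit.

Variables (F : fieldType) (n : nat).

Lemma leading_entry_exists (m : nat) (Z : 'M[F]_(m, n)) (i : 'I_m) :
  row i Z != 0 -> exists j, leading_entry Z i j.
Proof.
move=> Zi_neq0; have [j0 Zj0] : exists j, Z i j != 0.
  apply/existsP; apply: contraNT Zi_neq0 => /existsPn Zi0; apply/eqP/rowP => j.
  by rewrite !mxE; apply/eqP; rewrite -[_ == _]negbK Zi0.
case: (@arg_minnP _ j0 (fun j => Z i j != 0) val Zj0) => j Zj jmin.
exists j; split=> // k kj; apply/eqP; apply: contraTT kj => Zk.
by rewrite -leqNgt jmin.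
Qed.

Lemma increasing_ord_id (f : 'I_n -> 'I_n) :
  (forall i j : 'I_n, (i < j)%N -> (f i < f j)%N) -> forall i, f i = i.
Proof.
move=> f_incr.
have f_ge k (i : 'I_n) : (i : nat) = k -> (k <= f i)%N.
  elim: k i => // k IHk i ik.
  have kn : (k < n)%N by apply: ltn_trans (ltn_ord i); rewrite ik.
  apply: (leq_ltn_trans (IHk (Ordinal kn) erefl)).
  by apply: f_incr; rewrite ik /=.
(* Here [k] counts the indices above [i]: their images are [k] increasing values above [f i] and
   below [n]. Hence [f i <= i], the counterpart of [f_ge]. *)
have f_le k (i : 'I_n) : (n - i.+1)%N = k -> (f i + k < n)%N.
  elim: k i => [|k IHk] i ik; first by rewrite addn0.
  have iSn : (i.+1 < n)%N by rewrite -subn_gt0 ik.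
  have := IHk (Ordinal iSn); rewrite /= subnS ik => /(_ erefl).
  apply: leq_trans; rewrite addnS ltnS.
  by rewrite -addSn leq_add2r f_incr /=.
move=> i; apply: val_inj => /=.
by have := f_ge _ i erefl; have := f_le _ i erefl; have := ltn_ord i; lia.
Qed.

(** Invertibility excludes zero rows, so each row has a pivot. The pivot columns increase strictly
    within ['I_n], which puts them all on the diagonal. *)
Lemma unitmx_rref_eq1 (Z : 'M[F]_n) : Z \in unitmx -> is_rref Z -> Z = 1%:M.
Proof.
move=> Zunit [_ Zlead Zone Zcol].
have /fin_all_exists[f fP] (i : 'I_n) : exists j, leading_entry Z i j.
  apply: leading_entry_exists; apply/negP => /eqP Zi0.
  have := Zunit; rewrite -row_free_unit => /row_freeP[Y ZY].
  have := congr1 (row i) ZY; rewrite row_mul Zi0 mul0mx => /rowP/(_ i)/eqP.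
  by rewrite !mxE eqxx eq_sym oner_eq0.
have fid : forall i, f i = i.
  by apply: increasing_ord_id => i j ij; exact: Zlead ij (fP i) (fP j).
apply/matrixP => i j; rewrite mxE; have := fP j; rewrite fid => Zj.
by have [->|ij] := eqVneq i j; [exact: Zone | exact: Zcol Zj ij].
Qed.

Lemma is_identity_rref (m : nat) (Z : 'M[F]_(m, n)) :
  m = n -> row_free Z -> is_rref Z -> is_identity_mx Z.
Proof.
(* Replacing [m] by [n] lets the cast in [is_identity_mx] be taken along reflexivity. *)
move=> mn; subst m; rewrite row_free_unit => Zunit Zrref.
by exists erefl; rewrite castmx_id; exact: unitmx_rref_eq1.
Qed.

End ReducedRowEchelonForm.

(** * The walk matrix and the walk-regular partition *)

Section WalkMatrix.

Set Implicit Arguments.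
Unset Strict Implicit.

Variables (F : fieldType) (X : finType) (A : 'M[F]_#|X|) (d r : nat).
Variable (Rel : 'I_r.+1 -> {set X * X}).
Hypothesis RelP : enumerates_walk_partition A d Rel.

Local Notation W := (walk_matrix A d Rel).
Local Notation w p := (walk_vec A d p.1 p.2).

Lemma entry_powers (c : 'I_d.+1 -> F) (p : X * X) :
  entry (\sum_i c i *: A ^+ i) p.1 p.2 = \sum_i c i * w p i 0.
Proof. by rewrite /entry summxE; apply: eq_bigr => i _; rewrite !mxE. Qed.

Lemma eq_entry (B C : 'M[F]_#|X|) :
  (forall p : X * X, entry B p.1 p.2 = entry C p.1 p.2) -> B = C.
Proof.
move=> BC; apply/matrixP => i j.
by have := BC (enum_val i, enum_val j); rewrite /entry /= !enum_valK.
Qed.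

Lemma walk_class_eq (j : 'I_r.+1) :
  exists p : X * X, Rel j = [set q | w p == w q].
Proof.
have : Rel j \in walk_partition A d by rewrite -RelP.2 imset_f.
case/imsetP => p _ ->; exists p; apply/setP => q.
by rewrite !inE.
Qed.

Lemma walk_class_cover (p : X * X) : exists j, p \in Rel j.
Proof.
have : [set q in [set: X * X] | w p == w q] \in walk_partition A d.
  exact: (imset_f (fun x : X * X => [set q in [set: X * X] | w x == w q])).
rewrite -RelP.2 => /imsetP[j _ Ep]; exists j.
by rewrite -Ep !inE eqxx.
Qed.

Lemma walk_class_neq0 (j : 'I_r.+1) : exists p, p \in Rel j.
Proof. by have [p ->] := walk_class_eq j; exists p; rewrite inE. Qed.

(** The pair picked in [walk_matrix] shares the class of [p], hence its walk vector; the default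
    value 0 never occurs, as [p] witnesses that the class is nonempty. *)
Lemma col_walk_matrix (j : 'I_r.+1) (p : X * X) : p \in Rel j -> col j W = w p.
Proof.
move=> pj; apply/colP => i; rewrite !mxE; case: pickP => [q qj|/(_ p)]; last first.
  by rewrite pj.
have [x Ej] := walk_class_eq j; move: pj qj; rewrite Ej !inE => /eqP -> /eqP.
by move=> /colP/(_ i); rewrite !mxE => ->.
Qed.

Lemma walk_matrixE (i : 'I_d.+1) (j : 'I_r.+1) (p : X * X) :
  p \in Rel j -> W i j = w p i 0.
Proof. by move=> pj; rewrite -(col_walk_matrix pj) [RHS]mxE. Qed.

Lemma col_walk_matrix_inj : injective (fun j => col j W).
Proof.
move=> j k /= jk; apply: RelP.1.
have [p pj] := walk_class_neq0 j; have [q qk] := walk_class_neq0 k.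
move: jk; rewrite (col_walk_matrix pj) (col_walk_matrix qk).
have [x Ej] := walk_class_eq j; have [y Ek] := walk_class_eq k.
by move: pj qk; rewrite Ej Ek !inE => /eqP -> /eqP -> ->.
Qed.

Lemma walk_class_uniq (j k : 'I_r.+1) (p : X * X) :
  p \in Rel j -> (p \in Rel k) = (j == k).
Proof.
move=> pj; apply/idP/eqP => [pk|<- //]; apply: col_walk_matrix_inj.
by rewrite (col_walk_matrix pj) (col_walk_matrix pk).
Qed.

(** The order left by [undup] need not follow the numbering of [Rel]; a permutation suffices to
    transfer size and freeness. *)
Lemma perm_walk_vecs :
  perm_eq (walk_vecs A d) [tuple col j W | j < r.+1].
Proof.
apply: uniq_perm; first exact: undup_uniq.
  by rewrite map_inj_uniq ?enum_uniq //; exact: col_walk_matrix_inj.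
move=> v; rewrite mem_undup; apply/mapP/mapP => -[].
  move=> p _ ->; have [j pj] := walk_class_cover p.
  by exists j; rewrite ?mem_enum // (col_walk_matrix pj).
move=> j _ ->; have [p pj] := walk_class_neq0 j.
by exists p; rewrite ?mem_enum // (col_walk_matrix pj).
Qed.

Lemma size_walk_vecs : size (walk_vecs A d) = r.+1.
Proof. by rewrite (perm_size perm_walk_vecs) size_tuple. Qed.

(** A dependency between the columns is a vector [k] with [W k = 0], and a left inverse of [W] kills
    it. *)
Lemma free_walk_vecs : row_full W -> free (walk_vecs A d).
Proof.
move=> /row_fullP[C CW]; rewrite (perm_free perm_walk_vecs).
apply/freeP => k Wk0 j.
have Wk : W *m \col_j k j = 0.
  rewrite -Wk0; apply/colP => i; rewrite !mxE summxE; apply: eq_bigr => l _.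
  by rewrite (nth_map ord0) ?size_enum_ord // nth_ord_enum !mxE mulrC.
have /colP/(_ j) : C *m (W *m \col_j k j) = 0 by rewrite Wk mulmx0.
by rewrite mulmxA CW mul1mx !mxE.
Qed.

(** If [c *m W = 0], then the combination of powers of [A] with coefficients [c] vanishes at every
    pair, because the classes cover [X * X]. *)
Lemma walk_matrix_row_free : has_distinct_eigenvalues A d.+1 -> row_free W.
Proof.
move=> Ad; rewrite -kermx_eq0; apply/eqP/row_matrixP => k; rewrite row0.
set c := row k _; have cW : c *m W = 0 by rewrite -row_mul mulmx_ker row0.
suff c0 : forall i, c 0 i = 0 by apply/rowP => i; rewrite c0 mxE.
apply: (powers_independent (A := A)) => //; apply: eq_entry => p.
have [j pj] := walk_class_cover p.
rewrite entry_powers /entry [RHS]mxE.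
have /rowP/(_ j) := cW; rewrite [LHS]mxE [RHS]mxE => cWj; rewrite -[RHS]cWj.
by apply: eq_bigr => i _; rewrite (walk_matrixE _ pj).
Qed.

Lemma entry_rel_mx (S : {set X * X}) (p : X * X) :
  entry (rel_mx F S) p.1 p.2 = (p \in S)%:R.
Proof. by rewrite /entry mxE !enum_rankK -surjective_pairing. Qed.

Lemma quotient_polynomialP : quotient_polynomial A d Rel <-> row_full W.
Proof.
have sizeA : size [seq A ^+ (i : 'I_d.+1) | i : 'I_d.+1] == d.+1.
  by rewrite size_map -cardE card_ord.
have nthA (i : 'I_d.+1) : [seq A ^+ (i : 'I_d.+1) | i : 'I_d.+1]`_i = A ^+ i.
  by rewrite (nth_map ord0) ?size_enum_ord // nth_ord_enum.
split=> [qp|/row_fullP[C CW] j].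
  apply/row_fullP.
  have /fin_all_exists[c cP] (j : 'I_r.+1) :
      exists c : 'I_d.+1 -> F, rel_mx F (Rel j) = \sum_i c i *: A ^+ i.
    have := coord_span (X := Tuple sizeA) (qp j) => Ej.
    exists (fun i => coord (Tuple sizeA) i (rel_mx F (Rel j))).
    by rewrite {1}Ej; apply: eq_bigr => i _; rewrite nthA.
  (* At a pair of class [k], the expansion of the [j]-th class matrix reads as entry [(j, k)] of the
     product with [W], and its value is 1 or 0 according to whether [j = k]. *)
  exists (\matrix_(j, i) c j i); apply/matrixP => j k.
  have [p pk] := walk_class_neq0 k.
  have := entry_rel_mx (Rel j) p; rewrite cP entry_powers.
  rewrite (walk_class_uniq _ pk) eq_sym => cw; rewrite [LHS]mxE [RHS]mxE -cw.
  by apply: eq_bigr => i _; rewrite mxE (walk_matrixE _ pk).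
have -> : rel_mx F (Rel j) = \sum_i C j i *: A ^+ i.
  apply: eq_entry => p; rewrite entry_rel_mx entry_powers.
  have [k pk] := walk_class_cover p.
  rewrite (walk_class_uniq _ pk) eq_sym.
  have /matrixP/(_ j k) := CW; rewrite [LHS]mxE [RHS]mxE => <-.
  by apply: eq_bigr => i _; rewrite (walk_matrixE _ pk).
apply: memv_suml => i _; apply: memvZ; apply: memv_span.
by apply/mapP; exists i; rewrite ?mem_enum.
Qed.

End WalkMatrix.

Theorem theorem5p10 (R : realType) (X : finType) (e : rel X)
  (e_sym : symmetric e) (e_irr : irreflexive e) (e_conn : connected_graph e)
  (A : 'M[R[i]]_#|X|) (defA : A = adj_mx R[i] e)
  (d : nat) (Ad : has_distinct_eigenvalues A d.+1)
  (r : nat) (Rel : 'I_r.+1 -> {set X * X})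
  (RelP : enumerates_walk_partition A d Rel)
  (Z : 'M[R[i]]_(d.+1, r.+1)) (ZP : rref_of (walk_matrix A d Rel) Z) :
  (d <= r)%N /\
  [<-> d = r;
       is_identity_mx Z;
       size (walk_vecs A d) = d.+1;
       free (walk_vecs A d);
       quotient_polynomial A d Rel].
Proof.
have Wfree := walk_matrix_row_free RelP Ad.
have rankW : \rank (walk_matrix A d Rel) = d.+1 by exact/eqP.
have d_le_r : (d <= r)%N.
  by rewrite -ltnS -rankW; exact: rank_leq_col.
have sizeW := size_walk_vecs RelP.
have fullE : row_full (walk_matrix A d Rel) = (d == r).
  by rewrite /row_full rankW eqSS.
split=> //; tfae.
- move=> dr; have [[P Punit defZ] Zrref] := ZP.
  apply: is_identity_rref => //; first by rewrite dr.
  (* Left multiplication by the invertible [P] preserves the rank of [W]. *)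
  by rewrite /row_free defZ eqmxMfull ?row_full_unit // rankW.
- by case=> rd _; rewrite sizeW.
- rewrite sizeW => -[rd]; apply: (free_walk_vecs RelP).
  by rewrite fullE rd.
- move=> Wf; apply/(quotient_polynomialP RelP).
  (* The [r.+1] walk vectors are independent in a space of dimension [d.+1], so [r <= d]. *)
  rewrite fullE eqn_leq d_le_r -ltnS -sizeW.
  move: Wf; rewrite /free => /eqP <-; apply: (leq_trans (dimvS (subvf _))).
  by rewrite dimvf /dim /= muln1.
- by move=> /(quotient_polynomialP RelP); rewrite fullE => /eqP.
Qed.
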